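(* Let $m\ge 1$ and let $\pi_1,\dots,\pi_m$ be positive integers with $n=\pi_1+\dots+\pi_m$. Let $\bm{A}=\mathrm{blkdiag}(\bm{A}^{(1)},\dots,\bm{A}^{(m)})\in\mathbb{R}^{n\times n}$ and $\bm{B}=\mathrm{blkdiag}(\bm{e}^{\pi_1}_{\pi_1},\dots,\bm{e}^{\pi_m}_{\pi_m})\in\mathbb{R}^{n\times m}$ be as described in the context, and for real numbers $s<t$ let $$\bm{M}_{ts}=\int_s^t e^{\bm{A}(t-\tau)}\bm{B}\bm{B}^\top e^{\bm{A}^\top(t-\tau)}\,d\tau$$ be the controllability Gramian on $[s,t]$. Then $\bm{M}_{ts}=\mathrm{blkdiag}(\bm{M}^{(1)}_{ts},\dots,\bm{M}^{(m)}_{ts})$ with $\bm{M}^{(k)}_{ts}\in\mathbb{R}^{\pi_k\times\pi_k}$, and: (i) $\displaystyle \det(\bm{M}_{ts})=\prod_{k=1}^m\Big\{(t-s)^{\pi_k^2}\prod_{r=1}^{\pi_k}\frac{\Gamma(r)}{\Gamma(\pi_k+r)}\Big\}$; (ii) $\bm{M}_{ts}^{-1}=\mathrm{blkdiag}\big((\bm{M}^{(1)}_{ts})^{-1},\dots,(\bm{M}^{(m)}_{ts})^{-1}\big)$, where for each $k\in\{1,\dots,m\}$ and $i,j\in\{1,\dots,\pi_k\}$, $$\Big[(\bm{M}^{(k)}_{ts})^{-1}\Big]_{ij}=\frac{(\pi_k-i)!\,(\pi_k-j)!}{(2\pi_k-i-j+1)\,(t-s)^{2\pi_k-i-j+1}}\cdot\frac{\prod_{r=1}^{\pi_k}(2\pi_k-i-r+1)(2\pi_k-j-r+1)}{\Big(\prod_{r=1,\,r\ne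 i}^{\pi_k}(r-i)\Big)\Big(\prod_{r=1,\,r\ne j}^{\pi_k}(r-j)\Big)}.$$
   Context: $\bm{e}^d_i$ denotes the $i$-th standard basis vector of $\mathbb{R}^d$, and $\bm{0}$ a zero column vector. For each $k$, $\bm{A}^{(k)}=[\bm{0}\mid \bm{e}^{\pi_k}_1\mid \bm{e}^{\pi_k}_2\mid\cdots\mid \bm{e}^{\pi_k}_{\pi_k-1}]\in\mathbb{R}^{\pi_k\times\pi_k}$ (i.e., the nilpotent shift matrix with ones on the superdiagonal; for $\pi_k=1$ it is the $1\times1$ zero matrix). $\mathrm{blkdiag}$ denotes the block-diagonal matrix with the given diagonal blocks. The pair $(\bm{A},\bm{B})$ is the Brunovsky normal form $\dot{\bm z}=\bm A\bm z+\bm B\tilde{\bm u}$ with vector relative degree $(\pi_1,\dots,\pi_m)$. $\Gamma$ is the Gamma function, $\Gamma(n)=(n-1)!$ for positive integers $n$. *)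

(* Defs.v *)
From HB Require Import structures.
From mathcomp Require Import all_boot all_order all_algebra.
From mathcomp Require Import all_classical all_reals all_analysis.
Set Implicit Arguments. Unset Strict Implicit. Unset Printing Implicit Defensive.
Import Order.TTheory GRing.Theory Num.Theory.
Import numFieldNormedType.Exports.
Local Open Scope ring_scope.

Definition expm (R : realType) (n : nat) (X : 'M[R]_n) : 'M[R]_n :=
  limn (series (fun k : nat => (k`!%:R)^-1 *: X ^+ k)).

Definition shift_mx (R : realType) (p : nat) : 'M[R]_p :=
  \matrix_(i < p, j < p) (j == i.+1 :> nat)%:R.

Definition last_basis (R : realType) (p : nat) : 'cV[R]_p :=
  \col_(i < p) (i == p.-1 :> nat)%:R.

Lemma sum1_ord (m : nat) : (\sum_(j < m) 1)%N = m.
Proof. by rewrite sum1_card card_ord. Qed.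

Definition brunA (R : realType) (m : nat) (pi : 'I_m -> nat)
  : 'M[R]_(\sum_(k < m) pi k) :=
  \mxdiag_(k < m) shift_mx R (pi k).

Definition brunB (R : realType) (m : nat) (pi : 'I_m -> nat)
  : 'M[R]_(\sum_(k < m) pi k, m) :=
  castmx (erefl, sum1_ord m)
    (\mxblock_(k < m, l < m)
       (if k == l then last_basis R (pi k) else (0 : 'M[R]_(pi k, 1)))).

Definition gramian (R : realType) (m : nat) (pi : 'I_m -> nat) (s t : R)
  : 'M[R]_(\sum_(k < m) pi k) :=
  \matrix_(i, j)
    (\int[@lebesgue_measure R]_(tau in [set x : R | s <= x <= t])
       ((expm ((t - tau) *: brunA R pi) *m brunB R pi *m (brunB R pi)^T
          *m expm ((t - tau) *: (brunA R pi)^T)) i j)).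

(* Main.v *)
Require Import Defs.
From HB Require Import structures.
From mathcomp Require Import all_boot all_order all_algebra.
From mathcomp Require Import all_classical all_reals all_analysis.
From mathcomp Require Import ring zify.
Set Implicit Arguments. Unset Strict Implicit. Unset Printing Implicit Defensive.
Import Order.TTheory GRing.Theory Num.Theory.
Import numFieldNormedType.Exports.
Local Open Scope ring_scope.

(** The matrix [A] is nilpotent, so its exponential is a finite sum and the
    [k]-th diagonal block of the integrand is [v v^T] with
    [v_i = (t - tau)^(pi_k - i) / (pi_k - i)!].  Integrating, each block of the
    Gramian is a Cauchy matrix [1 / (x_i + y_j)], with [x_i = pi_k - i] and
    [y_j = pi_k - j + 1], rescaled by diagonal matrices on both sides.  Its
    inverse is Lagrange interpolation of the polynomials [prod_(r != j) (X + y_r)]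
    from the nodes [x_i] to the points [-y_i]; its determinant comes from
    factoring the evaluations of these polynomials at both families of points
    through Vandermonde matrices. *)

(** * Cauchy matrices: interpolation, inverse and determinant *)

Section Cauchy.
Variables (F : fieldType) (n : nat).
Implicit Types x y c : 'I_n -> F.

Lemma size_prod_XsubC_neq c (j : 'I_n) :
  size (\prod_(r | r != j) ('X - (c r)%:P)) = n.
Proof.
rewrite -big_filter size_prod_XsubC.
have -> : size [seq r <- index_enum 'I_n | r != j] = #|predC1 j|.
  by rewrite size_filter -sum1_count sum1_card.
by rewrite cardC1 card_ord prednK // (leq_ltn_trans _ (ltn_ord j)).
Qed.

(** The difference between [q] and its interpolant has size at most [n] and vanishes at the [n]
    distinct nodes, hence is zero. *)
Lemma lagrange_interpolation x (q : {poly F}) (z : F) :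
  injective x -> (size q <= n)%N ->
  q.[z] = \sum_j q.[x j] * \prod_(r | r != j) ((z - x r) / (x j - x r)).
Proof.
move=> xI szq.
pose L j := \prod_(r | r != j) ('X - (x r)%:P).
pose q' := \sum_j (q.[x j] / (L j).[x j]) *: L j.
have LE j w : (L j).[w] = \prod_(r | r != j) (w - x r).
  by rewrite /L horner_prod; apply: eq_bigr => r _; rewrite !hornerE.
have L0 j : (L j).[x j] != 0.
  rewrite LE; apply/prodf_neq0 => r rj; rewrite subr_eq0.
  by apply: contra rj => /eqP/xI ->.
have q'E j : q'.[x j] = q.[x j].
  rewrite horner_sum (bigD1 j) //= big1 ?addr0 => [|k kj].
    by rewrite hornerZ mulfVK.
  by rewrite hornerZ [X in _ * X]LE (bigD1 j) 1?eq_sym //= subrr mul0r mulr0.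
suff {1}-> : q = q'.
  rewrite horner_sum; apply: eq_bigr => j _.
  by rewrite hornerZ !LE prodf_div mulrAC mulrA.
apply/eqP; rewrite -subr_eq0; apply/eqP.
apply: (@roots_geq_poly_eq0 _ _ [seq x i | i : 'I_n]).
- apply/allP => _ /mapP[j _ ->].
  by rewrite /root hornerD hornerN q'E subrr.
- by rewrite map_inj_uniq ?enum_uniq.
- rewrite size_map size_enum_ord; apply: (leq_trans (size_polyD _ _)).
  rewrite geq_max szq size_polyN; apply: (leq_trans (size_sum _ _ _)).
  apply/bigmax_leqP => j _; apply: (leq_trans (size_scale_leq _ _)).
  by rewrite size_prod_XsubC_neq.
Qed.

Definition cauchy_mx x y : 'M[F]_n := \matrix_(i, j) (x i + y j)^-1.

(** As an inverse it has transposed roles: rows go with [y], columns with [x]. *)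
Definition cauchy_inv x y : 'M[F]_n := \matrix_(i, j)
  ((x j + y i)^-1 * (\prod_r ((x r + y i) * (x j + y r)) /
     (\prod_(r | r != i) (y i - y r) * \prod_(r | r != j) (x j - x r)))).

Lemma prod_neq_div (G : 'I_n -> F) j : G j != 0 ->
  \prod_(r | r != j) G r = (G j)^-1 * \prod_r G r.
Proof. by move=> Gj; rewrite [in RHS](bigD1 j) //= mulKf. Qed.

(** Interpolate [prod_(r != k) (X + y r)] from the nodes [x j] to the point [- y i]. The value there
    is zero unless [i = k]; dividing by [D] turns it into the Kronecker delta, and the interpolation
    sum into the matrix product. *)
Lemma cauchy_invP x y : injective x -> injective y ->
  (forall i j, x i + y j != 0) -> cauchy_inv x y *m cauchy_mx x y = 1%:M.
Proof.
move=> xI yI xy0; apply/matrixP => i k; rewrite !mxE.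
pose q := \prod_(r | r != k) ('X - (- y r)%:P).
have qE z : q.[z] = \prod_(r | r != k) (z + y r).
  by rewrite /q horner_prod; apply: eq_bigr => r _; rewrite !hornerE opprK.
have := @lagrange_interpolation x q (- y i) xI.
rewrite size_prod_XsubC_neq => /(_ (leqnn n)).
pose D := \prod_(r | r != i) (y r - y i).
have D0 : D != 0.
  apply/prodf_neq0 => r ri; rewrite subr_eq0.
  by apply: contra ri => /eqP/yI ->.
have sgE (G : 'I_n -> F) j :
    \prod_(r | r != j) - G r = (-1) ^+ n.-1 * \prod_(r | r != j) G r.
  by rewrite (prodrN (predC1 j)) cardC1 card_ord.
have -> : q.[- y i] = D * (i == k)%:R.
  rewrite qE /D; have [->|ik] := eqVneq i k.
    by rewrite mulr1; apply: eq_bigr => r _; rewrite addrC.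
  by rewrite (bigD1 i) //= addNr mul0r mulr0.
move=> /(congr1 (fun w => D^-1 * w)); rewrite mulKf // => ->.
rewrite mulr_sumr; apply: eq_bigr => j _; rewrite !mxE.
rewrite qE (@prod_neq_div (fun r => x j + y r)) // prodf_div.
(* Changing sign over the [n - 1] indices [r != j] in the numerator, and over the [n - 1] indices
   [r != i] in the denominator, yields the same sign twice, and the two cancel. *)
under [X in _ = D^-1 * (_ * (X / _))]eq_bigr => r _ do rewrite -opprD addrC.
rewrite sgE (@prod_neq_div (fun r => x r + y i)) // big_split /=.
have -> : \prod_(r | r != i) (y i - y r) = (-1) ^+ n.-1 * D.
  by rewrite -sgE; apply: eq_bigr => r _; rewrite opprB.
rewrite !invfM -exprVn invrN1; ring.
Qed.

(** Groups the ordered pairs of distinct indices two by two, to match the shape of a Vandermonde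
    determinant. *)
Lemma prod_ord_neq (G : 'I_n -> 'I_n -> F) :
  \prod_j \prod_(r | r != j) G j r =
  \prod_(j < n) \prod_(r < n | (j < r)%N) (G j r * G r j).
Proof.
under [RHS]eq_bigr => j _ do rewrite big_split /=.
rewrite big_split /= [X in _ = _ * X](exchange_big_dep xpredT) //=.
rewrite -big_split /=; apply: eq_bigr => j _.
rewrite (bigID (fun r : 'I_n => (j < r)%N)) /=; congr (_ * _); apply: eq_bigl => r.
  by rewrite neq_ltn andbC; case: ltngtP.
by rewrite -leqNgt ltn_neqAle.
Qed.

(** Let [Q] hold the coefficients of the [q j]. Evaluation at the [x i] gives the Cauchy matrix with
    scaled rows ([E1]); evaluation at the [- y i] gives a diagonal matrix ([E2]). The second
    identity determines the determinant of [Q], the first then that of the Cauchy matrix. *)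
Lemma det_cauchy x y : injective y -> (forall i j, x i + y j != 0) ->
  \det (cauchy_mx x y) =
  (\prod_(i < n) \prod_(j < n | (i < j)%N) ((x j - x i) * (y j - y i))) /
  (\prod_i \prod_j (x i + y j)).
Proof.
move=> yI xy0.
pose q j := \prod_(r | r != j) ('X - (- y r)%:P).
have qE j z : (q j).[z] = \prod_(r | r != j) (z + y r).
  by rewrite /q horner_prod; apply: eq_bigr => r _; rewrite !hornerE opprK.
pose Q : 'M[F]_n := \matrix_(k, j) (q j)`_k.
have VQ (a : 'rV[F]_n) i j : ((Vandermonde n a)^T *m Q) i j = (q j).[a 0 i].
  rewrite mxE (@horner_coef_wide _ n) ?size_prod_XsubC_neq //.
  by apply: eq_bigr => k _; rewrite !mxE mulrC.
pose d := \row_i \prod_r (x i + y r).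
have E1 : diag_mx d *m cauchy_mx x y = (Vandermonde n (\row_i x i))^T *m Q.
  apply/matrixP => i j; rewrite VQ mul_diag_mx !mxE qE.
  by rewrite (@prod_neq_div (fun r => x i + y r)) // mulrC.
have E2 : (Vandermonde n (\row_i - y i))^T *m Q =
    diag_mx (\row_j \prod_(r | r != j) (y r - y j)).
  apply/matrixP => i j; rewrite VQ !mxE qE.
  have [->|ij] := eqVneq i j.
    by rewrite mulr1n; apply: eq_bigr => r _; rewrite addrC.
  by rewrite (bigD1 i) //= addNr mul0r mulr0n.
have detV (a : 'I_n -> F) : \det (Vandermonde n (\row_i a i)) =
    \prod_(i < n) \prod_(j < n | (i < j)%N) (a j - a i).
  rewrite det_Vandermonde; apply: eq_bigr => i _.
  by apply: eq_bigr => j _; rewrite !mxE.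
have detD (a : 'I_n -> F) : \det (diag_mx (\row_i a i)) = \prod_i a i.
  by rewrite det_diag; apply: eq_bigr => i _; rewrite mxE.
have := congr1 determinant E1; rewrite !det_mulmx det_tr detV detD => detC.
have := congr1 determinant E2; rewrite det_mulmx det_tr detV detD => detQ.
have d0 : \prod_i \prod_j (x i + y j) != 0.
  by apply/prodf_neq0 => i _; apply/prodf_neq0.
apply: (mulfI d0); rewrite detC mulrCA divff // mulr1.
under [RHS]eq_bigr => i _ do rewrite big_split /=.
rewrite [RHS]big_split /=; congr (_ * _).
(* It remains to compute [\det Q]; multiplying by the Vandermonde determinant at [- y], nonzero as
   [y] is injective, brings in [E2]. *)
have V0 : \prod_(i < n) \prod_(j < n | (i < j)%N) (- y j - - y i) != 0.
  apply/prodf_neq0 => i _; apply/prodf_neq0 => j ij.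
  rewrite opprK addrC subr_eq0; apply: contraTneq ij => /yI ->.
  by rewrite ltnn.
apply: (mulfI V0); rewrite detQ prod_ord_neq -big_split /=.
apply: eq_bigr => i _; rewrite -big_split /=.
by apply: eq_bigr => j _; ring.
Qed.

End Cauchy.

(** * Block-diagonal matrices and diagonal rescaling *)

Lemma det_castmx (R : comPzRingType) m n (e : m = n) (A : 'M[R]_m) :
  \det (castmx (e, e) A) = \det A.
Proof. by case: n / e; rewrite castmx_id. Qed.

Lemma det_mxdiag (R : comPzRingType) m (p_ : 'I_m -> nat)
    (B : forall i, 'M[R]_(p_ i)) :
  \det (\mxdiag_i B i) = \prod_i \det (B i).
Proof.
elim: m p_ B => [|m IHm] p_ B; last first.
  by rewrite mxdiag_recl det_castmx det_ublock IHm big_ord_recl.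
(* The size is an empty sum; the matrix is generalized so that its type can follow the rewriting of
   that sum to 0. *)
rewrite [RHS]big_ord0; move: (\mxdiag_i B i).
by rewrite big_ord0 => A; rewrite det_mx00.
Qed.

Lemma mul_mxdiag (R : pzSemiRingType) m (p_ : 'I_m -> nat)
    (A B : forall i, 'M[R]_(p_ i)) :
  \mxdiag_i A i *m \mxdiag_i B i = \mxdiag_i (A i *m B i).
Proof.
rewrite [X in _ *m X]/mxdiag mul_mxdiag_mxblock; apply/eq_mxblock => i j.
case: (eqVneq i j) => [<-|_]; last by rewrite mulmx0.
by rewrite !conform_mx_id.
Qed.

Lemma mulmx1_invmx (R : comUnitRingType) n (A B : 'M[R]_n) :
  B *m A = 1%:M -> invmx A = B.
Proof.
move=> BA; have [_ Au] := mulmx1_unit BA.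
by rewrite -[RHS]mulmx1 -(mulmxV Au) mulmxA BA mul1mx.
Qed.

Lemma mxdiag_unit (R : comUnitRingType) m (p_ : 'I_m -> nat)
    (A : forall i, 'M[R]_(p_ i)) :
  (forall i, A i \in unitmx) ->
  \mxdiag_i A i \in unitmx /\ invmx (\mxdiag_i A i) = \mxdiag_i invmx (A i).
Proof.
move=> Au.
have E : \mxdiag_i invmx (A i) *m \mxdiag_i A i = 1%:M.
  by rewrite mul_mxdiag -mxdiagZ; apply: eq_mxdiag => i; rewrite mulVmx.
by split; [case: (mulmx1_unit E) | exact: mulmx1_invmx].
Qed.

Lemma mulmx_rescale_inv (F : fieldType) n (B C : 'M[F]_n) (a b : 'I_n -> F) :
  (forall i, a i != 0) -> (forall i, b i != 0) -> B *m C = 1%:M ->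
  \matrix_(i, j) ((b i)^-1 * B i j * (a j)^-1) *m
  \matrix_(i, j) (a i * C i j * b j) = 1%:M.
Proof.
move=> a0 b0 /matrixP BC; apply/matrixP => i k.
transitivity ((b i)^-1 * (B *m C) i k * b k); last first.
  by rewrite BC !mxE; case: eqP => [->|_]; rewrite ?mulr0 ?mul0r ?mulr1 ?mulVf.
rewrite !mxE big_distrr big_distrl /=; apply: eq_bigr => j _.
by rewrite !mxE !mulrA mulfVK.
Qed.

(** * One Gramian block as a rescaled Cauchy matrix *)

Section GramianBlock.
Variables (F : numFieldType) (T : F) (p : nat).
Hypothesis T0 : T != 0.

(** The integrated block, with [T] standing for [t - s]. Indices start at 0, so [p.-1 - i] is [p]
    minus the usual row number. *)
Definition gramian_block : 'M[F]_p := \matrix_(i, j)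
  (T ^+ (p.-1 - i + (p.-1 - j)).+1 / (p.-1 - i + (p.-1 - j)).+1%:R /
   ((p.-1 - i)`!%:R * (p.-1 - j)`!%:R)).

Let x (i : 'I_p) : F := (p.-1 - i)%:R.
Let y (i : 'I_p) : F := (p - i)%:R.
(** The power of [T] in entry [(i, j)] has exponent [x i + y j], so it splits into a row factor and
    a column factor; the extra [T] from integration goes to the columns, in [b]. *)
Let a (i : 'I_p) : F := T ^+ (p.-1 - i) / (p.-1 - i)`!%:R.
Let b (i : 'I_p) : F := T ^+ (p - i) / (p.-1 - i)`!%:R.

Let fact0 k : k`!%:R != 0 :> F.
Proof. by rewrite pnatr_eq0 -lt0n fact_gt0. Qed.

Let subpS (i : 'I_p) : (p - i = (p.-1 - i).+1)%N.
Proof. by case: p i => [[]//|n i]; rewrite subSn // -ltnS. Qed.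

Let a0 i : a i != 0.
Proof. by rewrite mulf_neq0 ?expf_neq0 ?invr_eq0. Qed.

Let b0 i : b i != 0.
Proof. by rewrite mulf_neq0 ?expf_neq0 ?invr_eq0. Qed.

Let xI : injective x.
Proof.
move=> i j /eqP; rewrite eqr_nat => /eqP e; apply: val_inj => /=.
have := ltn_ord i; have := ltn_ord j; lia.
Qed.

Let yI : injective y.
Proof.
move=> i j /eqP; rewrite eqr_nat => /eqP e; apply: val_inj => /=.
have := ltn_ord i; have := ltn_ord j; lia.
Qed.

Let xE i : x i = p%:R - i%:R - 1.
Proof. by rewrite -addrA -opprD natr1 -natrB //; congr (_%:R); lia. Qed.

Let yE i : y i = p%:R - i%:R.
Proof. by rewrite /y natrB // ltnW. Qed.

Let xyE i j : x i + y j = (p.-1 - i + (p.-1 - j)).+1%:R.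
Proof. by rewrite -natrD subpS addnS. Qed.

Let xy0 i j : x i + y j != 0.
Proof. by rewrite xyE pnatr_eq0. Qed.

Let blockE : gramian_block = \matrix_(i, j) (a i * cauchy_mx x y i j * b j).
Proof.
apply/matrixP => i j; rewrite !mxE xyE /a /b subpS -addnS exprD !invfM addnS; ring.
Qed.

Let blockVE : \matrix_(i, j) ((b i)^-1 * cauchy_inv x y i j * (a j)^-1) *m
  gramian_block = 1%:M.
Proof.
by rewrite blockE; apply: mulmx_rescale_inv => //; exact: cauchy_invP.
Qed.

Lemma gramian_block_unit : gramian_block \in unitmx.
Proof. by have [] := mulmx1_unit blockVE. Qed.

Lemma invmx_gramian_block (i j : 'I_p) :
  let ii := (i : nat).+1 in
  let jj := (j : nat).+1 in
  invmx gramian_block i j =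
    ((p - ii)`!%:R * (p - jj)`!%:R) /
      ((2 * p%:R - ii%:R - jj%:R + 1) * T ^+ (2 * p + 1 - ii - jj))
    * ((\prod_(1 <= r < p.+1)
          ((2 * p%:R - ii%:R - r%:R + 1) * (2 * p%:R - jj%:R - r%:R + 1)))
       / ((\prod_(1 <= r < p.+1 | r != ii) (r%:R - ii%:R))
          * (\prod_(1 <= r < p.+1 | r != jj) (r%:R - jj%:R)))).
Proof.
move=> ii jj; rewrite (mulmx1_invmx blockVE) !mxE.
have xyE' (k l : 'I_p) : x k + y l = 2 * p%:R - k.+1%:R - l.+1%:R + 1.
  by rewrite xE yE -!natr1; ring.
have yyE (k l : 'I_p) : y k - y l = l.+1%:R - k.+1%:R.
  by rewrite !yE -!natr1; ring.
have xxE (k l : 'I_p) : x k - x l = l.+1%:R - k.+1%:R.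
  by rewrite !xE -!natr1; ring.
have neqE (k : 'I_p) : \prod_(1 <= r < p.+1 | r != k.+1) (r%:R - k.+1%:R) =
    \prod_(r < p | r != k) (r.+1%:R - k.+1%:R) :> F.
  by rewrite big_add1 big_mkord.
rewrite !neqE big_add1 big_mkord.
under eq_bigr do rewrite !xyE'.
under [\prod_(r | r != i) _]eq_bigr do rewrite yyE.
under [\prod_(r | r != j) _]eq_bigr do rewrite xxE.
have -> : \prod_(r < p) ((2 * p%:R - r.+1%:R - i.+1%:R + 1) *
      (2 * p%:R - j.+1%:R - r.+1%:R + 1)) =
   \prod_(r < p) ((2 * p%:R - ii%:R - r.+1%:R + 1) *
      (2 * p%:R - jj%:R - r.+1%:R + 1)) :> F.
  by apply: eq_bigr => r _; rewrite /ii /jj -!natr1; ring.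
rewrite xyE' /a /b /ii /jj.
(* The exponents come from [b i] and [a j]; no subtraction truncates since [i] and [j] are below
   [p]. *)
have -> : (2 * p + 1 - i.+1 - j.+1 = p - i + (p.-1 - j))%N.
  have := ltn_ord i; have := ltn_ord j; lia.
have -> : (p - i.+1 = p.-1 - i)%N by lia.
have -> : (p - j.+1 = p.-1 - j)%N by lia.
rewrite exprD !invfM !invrK.
have -> : 2 * p%:R - j.+1%:R - i.+1%:R + 1 = 2 * p%:R - i.+1%:R - j.+1%:R + 1 :> F.
  ring.
ring.
Qed.

Let prod_rev (G : nat -> F) : \prod_(i < p) G (p.-1 - i)%N = \prod_(i < p) G i.
Proof.
rewrite [RHS](reindex_inj rev_ord_inj); apply: eq_bigr => i _ /=.
by congr (G _); have := ltn_ord i; lia.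
Qed.

(** For a fixed larger index [j], both differences equal [-(j - i)], so the product over [i < j] is
    the square of the factorial of [j]. *)
Let prod_fact :
  \prod_(i < p) \prod_(j < p | (i < j)%N) ((x j - x i) * (y j - y i)) =
  (\prod_(i < p) i`!%:R) ^+ 2.
Proof.
rewrite (exchange_big_dep xpredT) //= -prodrXl; apply: eq_bigr => j _.
transitivity (\prod_(0 <= i < j) (j - i)%:R ^+ 2 : F).
  rewrite big_mkord (big_ord_widen_cond p xpredT (fun i => (j - i)%:R ^+ 2)) 1?ltnW //.
  apply: eq_bigr => i ij.
  have -> : y j - y i = - (j - i)%:R.
    by rewrite !yE natrB 1?ltnW //; ring.
  have -> : x j - x i = - (j - i)%:R.
    by rewrite !xE natrB 1?ltnW //; ring.
  by rewrite mulrNN.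
rewrite prodrXl -natr_prod; congr (_%:R ^+ _).
rewrite fact_prod big_add1 big_nat_rev /= add0n !big_mkord.
apply: eq_bigr => i _; have := ltn_ord i; lia.
Qed.

(** The factors are [p] consecutive integers descending from [p + (p.-1 - i)]: a falling
    factorial. *)
Let prod_row (i : 'I_p) :
  \prod_j (x i + y j) = (p + (p.-1 - i))`!%:R / (p.-1 - i)`!%:R.
Proof.
apply: (mulIf (fact0 (p.-1 - i))); rewrite divfK //.
rewrite -(ffact_fact (leq_addr (p.-1 - i) p)) addKn natrM; congr (_ * _).
rewrite ffact_prod natr_prod; apply: eq_bigr => j _.
by rewrite /x /y -natrD addnC addnBAC // ltnW.
Qed.

Lemma det_gramian_block :
  \det gramian_block =
  T ^+ (p ^ 2) * \prod_(1 <= r < p.+1) ((r.-1)`!%:R / ((p + r).-1)`!%:R).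
Proof.
have -> : gramian_block =
    diag_mx (\row_i a i) *m cauchy_mx x y *m diag_mx (\row_i b i).
  rewrite blockE; apply/matrixP => i j.
  by rewrite mul_mx_diag mul_diag_mx !mxE.
rewrite !det_mulmx !det_diag (det_cauchy yI xy0) prod_fact.
under eq_bigr => i _ do rewrite mxE.
under [X in _ * X = _]eq_bigr => i _ do rewrite mxE.
under [X in _ / X]eq_bigr => i _ do rewrite prod_row.
rewrite big_add1 /= big_mkord.
under [X in _ = _ * X]eq_bigr => r _ do rewrite addnS /=.
rewrite /a /b.
(* One [T] comes out of each [b i], giving [T ^+ p]; what remains is the product of the [a i]. *)
under [X in _ * X = _]eq_bigr => i _ do rewrite subpS exprS -mulrA.
rewrite [X in _ * X = _]big_split /= prodr_const card_ord.
rewrite !(prod_rev (fun k => T ^+ k / k`!%:R)).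
rewrite (prod_rev (fun k => (p + k)`!%:R / k`!%:R)).
rewrite !prodf_div !prodrXr.
have sumE k : (k ^ 2 = \sum_(i < k) i + \sum_(i < k) i + k)%N.
  elim: k => [|k IHk]; first by rewrite !big_ord0.
  rewrite !big_ord_recr /=; move: (\sum_(i < k) i)%N IHk => S.
  by rewrite -!mulnn; nia.
rewrite sumE !exprD.
have f0 : \prod_(i < p) i`!%:R != 0 :> F by apply/prodf_neq0.
have g0 : \prod_(i < p) (p + i)`!%:R != 0 :> F by apply/prodf_neq0.
by field; rewrite f0 g0.
Qed.

End GramianBlock.

(** * Exponentials of nilpotent matrices and of the shift *)

(** Separation is checked on each coordinate. It makes the limit that defines [expm] unique. *)
Lemma mx_hausdorff (K : realFieldType) m n : hausdorff_space 'M[K]_(m, n).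
Proof.
move=> M N MN; apply/matrixP => i j; apply: Rhausdorff => A B MA NB.
have [P [/= PA PB]] := MN _ _ (coord_continuous MA) (coord_continuous NB).
by exists (P i j).
Qed.

(** The partial sums of the series are constant from rank [N] on. *)
Lemma expm_nilpotent (R : realType) n (X : 'M[R]_n) N : X ^+ N = 0 ->
  expm X = \sum_(k < N) (k`!%:R)^-1 *: X ^+ k.
Proof.
move=> XN; apply: lim_near_cst; first exact: mx_hausdorff.
near=> k; rewrite /series /=.
have Nk : (N <= k)%N by near: k; exact: nbhs_infty_ge.
rewrite (big_cat_nat (leq0n N) Nk) /= big_mkord -[RHS]addr0.
congr (_ + _); rewrite big_nat big1 // => l /andP[Nl _].
by rewrite -(subnK Nl) exprD XN mulr0 scaler0.
Unshelve. all: by end_near. Qed.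

Lemma trmxX (R : comPzRingType) n (X : 'M[R]_n) k : (X ^+ k)^T = X^T ^+ k.
Proof.
elim: k => [|k IHk]; first by rewrite !expr0 trmx1.
by rewrite exprS exprSr -mulmxE trmx_mul IHk.
Qed.

Lemma expm_tr_nilpotent (R : realType) n (X : 'M[R]_n) N : X ^+ N = 0 ->
  expm X^T = (expm X)^T.
Proof.
move=> XN; have XTN : X^T ^+ N = 0 by rewrite -trmxX XN trmx0.
rewrite (expm_nilpotent XN) (expm_nilpotent XTN) raddf_sum /=.
by apply: eq_bigr => k _; rewrite linearZ /= trmxX.
Qed.

Lemma scale_mxdiag (R : pzRingType) m (p_ : 'I_m -> nat) c
    (A : forall i, 'M[R]_(p_ i)) :
  c *: \mxdiag_i A i = \mxdiag_i (c *: A i).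
Proof.
rewrite -mul_scalar_mx -mxdiagZ mul_mxdiag; apply: eq_mxdiag => i.
by rewrite mul_scalar_mx.
Qed.

Lemma mxdiagX (R : pzRingType) m (p_ : 'I_m -> nat)
    (A : forall i, 'M[R]_(p_ i)) k :
  (\mxdiag_i A i) ^+ k = \mxdiag_i (A i ^+ k).
Proof.
elim: k => [|k IHk]; first by rewrite expr0 -[LHS]mxdiagZ; exact: eq_mxdiag.
rewrite exprS IHk -[LHS]/(_ *m _) mul_mxdiag; apply: eq_mxdiag => i.
by rewrite exprS mulmxE.
Qed.

Lemma scale_shift_mxX (R : realType) (c : R) p k (i j : 'I_p) :
  ((c *: shift_mx R p) ^+ k) i j = (j == i + k :> nat)%N%:R * c ^+ k.
Proof.
elim: k j => [|k IHk] j.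
  by rewrite !expr0 addn0 mulr1 mxE eq_sym.
rewrite exprSr -mulmxE mxE.
under eq_bigr => l _ do rewrite IHk !mxE.
(* Only [l = i + k] contributes to the product, and this index exists only when it is below [p]. *)
have [ikp|pik] := ltnP (i + k)%N p.
  rewrite (bigD1 (Ordinal ikp)) //= eqxx big1 => [|l li].
    by rewrite addr0 addnS exprSr mul1r mulrA mulrC.
  rewrite (_ : (l == i + k :> nat)%N = false) ?mul0r //.
  by apply: contraNF li => /eqP e; apply/eqP/val_inj.
have -> : (j == i + k.+1 :> nat)%N = false by have := ltn_ord j; lia.
rewrite mul0r big1 // => l _.
by have -> : (l == i + k :> nat)%N = false; [have := ltn_ord l; lia | rewrite !mul0r].
Qed.

Lemma scale_shift_mx_nilpotent (R : realType) (c : R) p N : (p <= N)%N ->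
  (c *: shift_mx R p) ^+ N = 0.
Proof.
move=> pN; apply/matrixP => i j; rewrite scale_shift_mxX mxE.
by have -> : (j == i + N :> nat)%N = false; [have := ltn_ord j; lia | rewrite mul0r].
Qed.

(** Closed form of the exponential of [c] times the shift. Below the diagonal the truncated [j - i]
    is 0 and the quotient is 1, so the indicator is what makes the entry vanish. *)
Definition exp_shift_mx (R : realType) (c : R) p : 'M[R]_p :=
  \matrix_(i, j) ((i <= j)%N%:R * (c ^+ (j - i) / (j - i)`!%:R)).

(** Any cutoff [N] from [p] on is allowed, so that blocks of different sizes can share one. *)
Lemma exp_shift_mxE (R : realType) (c : R) p N : (p <= N)%N ->
  \sum_(k < N) (k`!%:R)^-1 *: (c *: shift_mx R p) ^+ k = exp_shift_mx c p.
Proof.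
move=> pN; apply/matrixP => i j; rewrite summxE !mxE.
under eq_bigr => k _ do rewrite mxE scale_shift_mxX.
have [ij|ji] := leqP i j; last first.
  rewrite mul0r big1 // => k _.
  by have -> : (j == i + k :> nat)%N = false; [lia | rewrite mul0r mulr0].
have jiN : (j - i < N)%N by have := ltn_ord j; lia.
rewrite (bigD1 (Ordinal jiN)) //= big1 => [|k kji].
  by rewrite subnKC // eqxx addr0 !mul1r mulrC.
rewrite (_ : (j == i + k :> nat)%N = false) ?mul0r ?mulr0 //.
by apply: contraNF kji => /eqP e; apply/eqP/val_inj; rewrite /= e addKn.
Qed.

(** * The Brunovsky pair, block by block *)

Lemma scale_brunA_nilpotent (R : realType) m (pi : 'I_m -> nat) (c : R) N :
  (forall k, (pi k <= N)%N) -> (c *: brunA R pi) ^+ N = 0.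
Proof.
move=> piN; rewrite scale_mxdiag mxdiagX -[RHS]mxdiag0; apply: eq_mxdiag => i.
exact: scale_shift_mx_nilpotent.
Qed.

Lemma expm_brunA (R : realType) m (pi : 'I_m -> nat) (c : R) :
  expm (c *: brunA R pi) = \mxdiag_k exp_shift_mx c (pi k).
Proof.
pose N := \max_k pi k.
have piN k : (pi k <= N)%N by exact: leq_bigmax.
rewrite (expm_nilpotent (scale_brunA_nilpotent c piN)).
under [LHS]eq_bigr => k _ do rewrite scale_mxdiag mxdiagX scale_mxdiag.
by rewrite -mxdiag_sum; apply: eq_mxdiag => i; exact: exp_shift_mxE.
Qed.

Lemma expm_brunA_tr (R : realType) m (pi : 'I_m -> nat) (c : R) :
  expm (c *: (brunA R pi)^T) = \mxdiag_k (exp_shift_mx c (pi k))^T.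
Proof.
have piN k : (pi k <= \max_k pi k)%N by exact: leq_bigmax.
rewrite -linearZ /= (expm_tr_nilpotent (scale_brunA_nilpotent c piN)).
by rewrite expm_brunA tr_mxdiag.
Qed.

(** Removes the cast on the number of columns in [brunB], which is summed over in the product with
    its transpose. *)
Lemma mulmx_castmx_tr (R : pzSemiRingType) m n n' (e : n = n') (A : 'M[R]_(m, n)) :
  castmx (erefl, e) A *m (castmx (erefl, e) A)^T = A *m A^T.
Proof. by case: n' / e; rewrite castmx_id. Qed.

Lemma mul_brunB_tr (R : realType) m (pi : 'I_m -> nat) :
  brunB R pi *m (brunB R pi)^T =
  \mxdiag_k (last_basis R (pi k) *m (last_basis R (pi k))^T).
Proof.
rewrite mulmx_castmx_tr tr_mxblock mul_mxblock; apply: eq_mxblock => i j.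
case: (eqVneq i j) => [<-|ij].
  rewrite conform_mx_id (bigD1 i) //= eqxx big1 ?addr0 // => k ki.
  by rewrite eq_sym (negPf ki) mul0mx.
rewrite big1 // => k _; case: (eqVneq i k) => [ik|_]; last by rewrite mul0mx.
by rewrite ik eq_sym in ij; rewrite (negPf ij) trmx0 mulmx0.
Qed.

(** * Entrywise integration and assembly of the Gramian *)

(** Here [I] stands for the integral over the time interval: entries outside the diagonal blocks are
    zero functions, which [I] sends to 0. *)
Lemma mxdiag_coordwise (R : nmodType) (Z : Type) m (p_ : 'I_m -> nat)
    (I : (Z -> R) -> R) (A : forall i, Z -> 'M[R]_(p_ i)) :
  I (fun=> 0) = 0 ->
  \matrix_(i, j) I (fun z => (\mxdiag_k A k z) i j) =
  \mxdiag_k \matrix_(i, j) I (fun z => A k z i j).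
Proof.
move=> I0; apply/matrixP => s t; rewrite !mxE.
under eq_fun => z do rewrite mxE.
rewrite /tagnat.sig1 /tagnat.sig2.
case: (tagnat.sig s) (tagnat.sig t) => [/= i j] [/= i' j'].
case: (eqVneq i i') j' => [<- j'|ii' j'].
  rewrite conform_mx_id mxE; congr I; apply: funext => z.
  by rewrite conform_mx_id.
by rewrite mxE -[RHS]I0; congr I; apply: funext => z; rewrite mxE.
Qed.

Lemma Rintegral_poly_deriv (R : realType) (q : {poly R}) (a b : R) : a < b ->
  \int[@lebesgue_measure R]_(x in `[a, b]%classic) (q^`()).[x] = q.[b] - q.[a].
Proof.
move=> ab; rewrite /Rintegral (@continuous_FTC2 _ _ (horner q)) //.
- by apply: continuous_in_subspaceT => x _; exact: continuous_horner.
- split=> [x _| |]; first exact: derivable_horner.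
  + by apply: cvg_at_right_filter; exact: continuous_horner.
  + by apply: cvg_at_left_filter; exact: continuous_horner.
- by move=> x _; rewrite -derivE.
Qed.

Lemma Rintegral_exprB (R : realType) (s t c : R) n : s < t ->
  \int[@lebesgue_measure R]_(x in [set x | s <= x <= t]%classic) ((t - x) ^+ n * c) =
  (t - s) ^+ n.+1 / n.+1%:R * c.
Proof.
(* A polynomial primitive of the integrand that vanishes at [t], so only the value at [s]
   survives. *)
move=> st; pose q : {poly R} := - (c / n.+1%:R) *: (t%:P - 'X) ^+ n.+1.
have -> : [set x | s <= x <= t]%classic = `[s, t]%classic by rewrite set_itvcc.
transitivity (\int[@lebesgue_measure R]_(x in `[s, t]%classic) (q^`()).[x]).
  apply: eq_Rintegral => x _.
  rewrite /q derivZ deriv_exp derivB derivC derivX sub0r !hornerE /=.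
  by rewrite hornerMn !hornerE; field; rewrite ?nat1r ?natr1 pnatr_eq0.
rewrite Rintegral_poly_deriv // !hornerE subrr expr0n /= mulr0 sub0r; ring.
Qed.

(** The last basis vector selects the last column of the exponential. *)
Lemma exp_shift_mx_last (R : realType) (c : R) p (i : 'I_p) z :
  (exp_shift_mx c p *m last_basis R p) i z =
  c ^+ (p.-1 - i) / (p.-1 - i)`!%:R.
Proof.
have pp : (p.-1 < p)%N by have := ltn_ord i; lia.
rewrite mxE (bigD1 (Ordinal pp)) //= !mxE eqxx mulr1 big1 => [|l lp].
  rewrite addr0 (_ : (i <= p.-1)%N) ?mul1r //; have := ltn_ord i; lia.
rewrite !mxE (_ : (l == p.-1 :> nat) = false) ?mulr0 //.
by apply: contraNF lp => /eqP e; apply/eqP/val_inj.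
Qed.

Lemma gramian_integrand (R : realType) m (pi : 'I_m -> nat) (c : R) :
  expm (c *: brunA R pi) *m brunB R pi *m (brunB R pi)^T
    *m expm (c *: (brunA R pi)^T) =
  \mxdiag_k (\matrix_(i < pi k, j < pi k)
    (c ^+ ((pi k).-1 - i + ((pi k).-1 - j)) *
     (((pi k).-1 - i)`!%:R * ((pi k).-1 - j)`!%:R)^-1)).
Proof.
rewrite -(mulmxA _ (brunB R pi)) mul_brunB_tr expm_brunA expm_brunA_tr !mul_mxdiag.
(* Regrouping exhibits the block as a column times its own transpose. *)
apply: eq_mxdiag => k; rewrite mulmxA -mulmxA -trmx_mul.
apply/matrixP => i j; rewrite mxE big_ord1 [X in _ * X]mxE !exp_shift_mx_last mxE.
by rewrite exprD invfM; ring.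
Qed.

Lemma gramianE (R : realType) m (pi : 'I_m -> nat) (s t : R) : s < t ->
  gramian pi s t = \mxdiag_k gramian_block (t - s) (pi k).
Proof.
move=> st; rewrite /gramian.
under eq_mx => i j do under eq_Rintegral => x _ do rewrite gramian_integrand.
rewrite (@mxdiag_coordwise _ _ _ _
  (fun f => \int[@lebesgue_measure R]_(x in [set x | s <= x <= t]%classic) f x)).
  apply: eq_mxdiag => k; apply/matrixP => i j; rewrite !mxE.
  under eq_Rintegral => x _ do rewrite mxE.
  by rewrite Rintegral_exprB.
by rewrite /Rintegral integral0.
Qed.

Theorem theorem1 (R : realType) (m : nat) (pi : 'I_m -> nat) (s t : R) :
  (1 <= m)%N -> (forall k, (1 <= pi k)%N) -> s < t ->
  exists Mk : forall k : 'I_m, 'M[R]_(pi k),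
    gramian pi s t = \mxdiag_(k < m) Mk k /\
    (* (i) determinant; Gamma(r) = (r-1)!, Gamma(pi_k + r) = (pi_k + r - 1)! *)
    \det (gramian pi s t) =
      \prod_(k < m) ((t - s) ^+ (pi k ^ 2) *
        \prod_(1 <= r < (pi k).+1) ((r.-1)`!%:R / ((pi k + r).-1)`!%:R)) /\
    (* (ii) inverse *)
    gramian pi s t \in unitmx /\
    (forall k, Mk k \in unitmx) /\
    invmx (gramian pi s t) = \mxdiag_(k < m) invmx (Mk k) /\
    (forall (k : 'I_m) (i j : 'I_(pi k)),
      let p := pi k in
      let ii := (i : nat).+1 in
      let jj := (j : nat).+1 in
      invmx (Mk k) i j =
        ((p - ii)`!%:R * (p - jj)%N`!%:R) /
          ((2 * p%:R - ii%:R - jj%:R + 1) * (t - s) ^+ (2 * p + 1 - ii - jj))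
        * ((\prod_(1 <= r < p.+1)
              ((2 * p%:R - ii%:R - r%:R + 1) * (2 * p%:R - jj%:R - r%:R + 1)))
           / ((\prod_(1 <= r < p.+1 | r != ii) (r%:R - ii%:R))
              * (\prod_(1 <= r < p.+1 | r != jj) (r%:R - jj%:R))))).
Proof.
move=> _ _ st; have T0 : t - s != 0 by rewrite subr_eq0 gt_eqF.
have Bu k : gramian_block (t - s) (pi k) \in unitmx.
  exact: gramian_block_unit.
have [Gu GV] := mxdiag_unit Bu; rewrite -gramianE // in Gu GV.
exists (fun k => gramian_block (t - s) (pi k)); split; first exact: gramianE.
split; first by rewrite gramianE // det_mxdiag; apply: eq_bigr => k _;
  rewrite det_gramian_block.
by do 3![split=> //]; move=> k i j; exact: invmx_gramian_block.
Qed.
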